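(* Let $(d(t),\,t\ge0)$ be a nonnegative, locally integrable, weakly decreasing demand function, and fix an initial energy configuration $(E_i(0),\,i\in\mathcal S)$. If there is a cross-charging policy that completely serves $d$ on $[0,\infty)$, then $d$ is also completely served on $[0,\infty)$ without cross-charging (i.e. with $r_i(t)\ge0$ for all $i,t$), namely by the GGDDF policy.
   Context: A finite set $\mathcal S$ of energy stores is given. Store $i\in\mathcal S$ has capacity $\overline E_i>0$, maximum discharge rate $P_i>0$, maximum charge rate $P'_i\ge0$ and round-trip efficiency $\eta_i\in(0,1]$. A cross-charging policy is a choice of measurable rate functions $(r_i(t),\,t\ge0)$ with $E_i(t)=E_i(0)-\int_0^t r_i(u)\,du$, subject to $0\le E_i(t)\le\overline E_i$, $-P'_i\le r_i(t)\le P_i$, and $$0\le\sum_{i:\,r_i(t)\ge0}r_i(t)+\sum_{i:\,r_i(t)<0}r_i(t)/\eta_i\le d(t)\quad\text{for all }t\ge0$$ (negative $r_i$ means store $i$ is charged, drawing energy at rate $-r_i/\eta_i$ from other stores; no external energy is available). It completely serves $d$ on an interval $I$ if the middle expression equals $d(t)$ for almost every $t\in I$. A policy with all $r_i(t)\ge0$ is one without cross-charging. GGDDF (greedy greatest-discharge-duration-first) policy: at (almost) every time $t$, the total served rate is $\bar d(t)=\min\bigl(d(t),\sum_{i:E_i(t)>0}P_i\bigr)$, and it is allocated as follows: the nonempty stores are partitioned into groups $G_1,G_2,\dots$ of equal discharge-duration $E_i(t)/P_i$, listed in strictly decreasing order of that duration; letting $m$ be the least index with $\sum_{k\le m}\sum_{i\in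 G_k}P_i\ge\bar d(t)$, every store in $G_k$ with $k<m$ discharges at rate $P_i$, every store $i\in G_m$ discharges at rate $\lambda P_i$ with $\lambda\in(0,1]$ chosen so that $\sum_i r_i(t)=\bar d(t)$, and all other stores have rate $0$ (all rates are $0$ if $\bar d(t)=0$). *)

(* Defs.v *)
From HB Require Import structures.
From mathcomp Require Import all_boot all_order all_algebra.
From mathcomp Require Import all_classical all_reals all_analysis.
Set Implicit Arguments. Unset Strict Implicit. Unset Printing Implicit Defensive.
Import Order.TTheory GRing.Theory Num.Theory.
Local Open Scope classical_set_scope.
Local Open Scope ring_scope.

Section Stores.
Variables (R : realType) (S : finType).
(* store data: capacity Ebar, max discharge P, max charge P', efficiency eta,
   initial energies E0 *)
Variables (Ebar P P' eta E0 : S -> R).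

Definition energy (r : S -> R -> R) (i : S) (t : R) : R :=
  E0 i - Rintegral lebesgue_measure `[0, t] (r i).

(* the middle expression of the constraint: discharged rates plus energy drawn
   for charging *)
Definition served (r : S -> R -> R) (t : R) : R :=
  \sum_(i : S) (if 0 <= r i t then r i t else r i t / eta i).

Definition policy (d : R -> R) (r : S -> R -> R) : Prop :=
  (forall i, measurable_fun [set t : R | 0 <= t] (r i)) /\
  (forall i t, 0 <= t -> 0 <= energy r i t <= Ebar i) /\
  (forall i t, 0 <= t -> - P' i <= r i t <= P i) /\
  (forall t, 0 <= t -> 0 <= served r t <= d t).

Definition completely_serves (d : R -> R) (r : S -> R -> R) : Prop :=
  {ae lebesgue_measure, forall t : R, 0 <= t -> served r t = d t}.

(* GGDDF allocation rule at a given time, for energies e and rates x.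
   Nonempty stores: e i > 0; discharge duration e i / P i.
   For a nonempty store i, [higher i] is the total maximal discharge rate of the
   groups of strictly larger duration, and [upto i] that of the groups of
   duration >= that of i.  The group of i has index < m iff upto i < dbar,
   index = m iff higher i < dbar <= upto i, index > m iff dbar <= higher i. *)
Definition ggddf_rule (dt : R) (e x : S -> R) : Prop :=
  let dur i := e i / P i in
  let dbar := Num.min dt (\sum_(j | 0 < e j) P j) in
  let higher i := \sum_(j | (0 < e j) && (dur i < dur j)) P j in
  let upto i := \sum_(j | (0 < e j) && (dur i <= dur j)) P j in
  if dbar == 0 then forall i, x i = 0
  else exists2 lambda : R, 0 < lambda <= 1 &
    (forall i, x i =
       if ~~ (0 < e i) then 0
       else if upto i < dbar then P i
       else if higher i < dbar then lambda * P i
       else 0) /\ \sum_i x i = dbar.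

Definition ggddf (d : R -> R) (r : S -> R -> R) : Prop :=
  {ae lebesgue_measure, forall t : R, 0 <= t ->
     ggddf_rule (d t) (fun i => energy r i t) (fun i => r i t)}.

End Stores.

(* Main.v *)
Require Import Defs.
From HB Require Import structures.
From mathcomp Require Import all_boot all_order all_algebra.
From mathcomp Require Import all_classical all_reals all_analysis.
From mathcomp Require Import measurable_realfun lra.
Set Implicit Arguments.
Unset Strict Implicit.
Unset Printing Implicit Defensive.
Import Order.TTheory GRing.Theory Num.Theory.
Import numFieldNormedType.Exports.
Local Open Scope classical_set_scope.
Local Open Scope ring_scope.

(* Whatever the cross-charging, the stores can supply by time t at most
   \sum_(i in A) P i * t + \sum_(i notin A) E0 i, for every set A of stores.
   GGDDF never reverses the order of the discharge durations E i / P i.  Hence,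
   if the stores A that are nonempty at time t have \sum_A P < d t <= d u for
   u <= t, they formed a top set of durations at every such time u, and so they
   discharged at full rate throughout [0, t], while the other stores were
   emptied: GGDDF has supplied at least the above bound, hence all the demand up
   to t.  Therefore the shortage times form a null set.

   A GGDDF policy exists because, as long as the order of the durations does not
   change, its rates are an explicit function of d t; each change of the order
   merges two durations (or empties a store), so there are finitely many
   phases. *)

(** * The greedy allocation at a fixed instant *)

Section AllocationRule.
Variables (R : realType) (S : finType) (P : S -> R).
Hypothesis P_gt0 : forall i, 0 < P i.
Implicit Types (e x : S -> R) (b : R).

Definition pool e : R := \sum_(j | 0 < e j) P j.
Definition higher e i : R :=
  \sum_(j | (0 < e j) && (e i / P i < e j / P j)) P j.
Definition upto e i : R :=
  \sum_(j | (0 < e j) && (e i / P i <= e j / P j)) P j.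

Lemma ler_sum_subset (A B : pred S) : (forall k, A k -> B k) ->
  \sum_(k | A k) P k <= \sum_(k | B k) P k.
Proof.
move=> AB; rewrite big_mkcond [leRHS]big_mkcond; apply: ler_sum => k _.
have := AB k; case: (A k) => [->//|_]; case: (B k) => //; exact: ltW.
Qed.

Lemma sum_rate_ge0 (A : pred S) : 0 <= \sum_(k | A k) P k.
Proof. by apply: sumr_ge0 => k _; exact: ltW. Qed.

Lemma higher_le_upto e i : higher e i <= upto e i.
Proof. by apply: ler_sum_subset => k /andP[-> /ltW]. Qed.

Lemma upto_le_pool e i : upto e i <= pool e.
Proof. by apply: ler_sum_subset => k /andP[]. Qed.

Lemma upto_le_higher e i j : e j / P j < e i / P i -> upto e i <= higher e j.
Proof.
by move=> ji; apply: ler_sum_subset => k /andP[-> /(lt_le_trans ji)].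
Qed.

Lemma duration_gt0 e i : (0 < e i / P i) = (0 < e i).
Proof. by rewrite pmulr_lgt0 // invr_gt0. Qed.

Lemma duration_le0 e i : (e i / P i <= 0) = (e i <= 0).
Proof. by rewrite !leNgt duration_gt0. Qed.

Lemma uptoE e i : upto e i = higher e i +
  \sum_(j | (0 < e j) && (e j / P j == e i / P i)) P j.
Proof.
rewrite /upto (bigID (fun j => e i / P i < e j / P j)) /=; congr (_ + _);
  apply: eq_bigl => j; rewrite -andbA; congr (_ && _).
  by case: (ltgtP (e i / P i)).
by case: (ltgtP (e i / P i)).
Qed.

Lemma higher_lt_upto e i : 0 < e i -> higher e i < upto e i.
Proof.
move=> ei; rewrite uptoE ltrDl (bigD1 i) ?ei ?eqxx //=.
by rewrite ltr_wpDr // sum_rate_ge0.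
Qed.

(** The consequences through which a given allocation is used from here on; they mention neither
    [lambda] nor group indices. When [b = 0] the fourth is vacuous, since [upto] is nonnegative. *)
Lemma ggddf_ruleP dt e x : ggddf_rule P dt e x ->
  let b := Num.min dt (pool e) in
  [/\ \sum_i x i = b, forall i, 0 <= x i <= P i,
      forall i, e i <= 0 -> x i = 0,
      forall i, 0 < e i -> upto e i < b -> x i = P i &
      forall i, b <= higher e i -> x i = 0].
Proof.
move=> rule b; move: rule; rewrite /ggddf_rule -/(pool e) -/b.
case: eqP => [b0 x0|_ [l /andP[l0 l1] [xE sx]]].
  split=> //; first by rewrite b0 big1.
    by move=> i; rewrite x0 lexx ltW.
  move=> i _; rewrite b0 ltNge => /negP[]; exact: sum_rate_ge0.
have {}xE i : x i = if ~~ (0 < e i) then 0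
       else if upto e i < b then P i
       else if higher e i < b then l * P i else 0 by exact: xE.
split=> //.
- move=> i; rewrite xE; have Pi := P_gt0 i.
  case: ifP => _; first by rewrite lexx ltW.
  case: ifP => _; first by rewrite lexx ltW.
  case: ifP => _; last by rewrite lexx ltW.
  by rewrite mulr_ge0 ?(ltW Pi) ?(ltW l0) //= ler_piMl ?(ltW Pi).
- by move=> i; rewrite xE leNgt => ->.
- by move=> i ei ub; rewrite xE ei ub.
- move=> i bh; rewrite xE; case: ifP => // _.
  by rewrite ltNge (le_trans bh (higher_le_upto _ _)) /= ltNge bh.
Qed.

(** If [j] discharges at all, the groups above it total less than [b]; the group of [i] is among
    them, so [i] runs at full rate and its ratio is 1, the maximum. *)
Lemma ggddf_rule_anti dt e x i j : ggddf_rule P dt e x ->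
  e j / P j < e i / P i -> x j / P j <= x i / P i.
Proof.
move=> /ggddf_ruleP[_ xb x0 xf xh] ji.
have [/andP[xi0 _] /andP[xj0 xjP]] := (xb i, xb j).
have zero : x j = 0 -> x j / P j <= x i / P i.
  by move=> ->; rewrite mul0r divr_ge0 // ltW.
have [/x0/zero//|ej] := leP (e j) 0.
have [/xh/zero//|hb] := leP (Num.min dt (pool e)) (higher e j).
have ei : 0 < e i.
  by rewrite -duration_gt0 (lt_trans _ ji) // duration_gt0.
rewrite (xf i ei) ?(le_lt_trans (upto_le_higher ji) hb) //.
by rewrite divff ?gt_eqF // ler_pdivrMr // mul1r.
Qed.

(** Here [A] is a union of top groups. Either all of them run at full rate, or some [i] in [A] has
    [b <= upto e i], which forces [b] to be the total of [A]; then every store outside [A] is idle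
    and [A] supplies all of [b]. *)
Lemma ggddf_rule_top dt e x (A : pred S) : ggddf_rule P dt e x ->
  (forall i, A i -> 0 < e i) ->
  (forall i j, A i -> ~~ A j -> e j / P j < e i / P i) ->
  \sum_(i | A i) P i <= dt -> \sum_(i | A i) x i = \sum_(i | A i) P i.
Proof.
move=> /ggddf_ruleP[sx xb x0 xf xh] A0 Atop Ad.
set b := Num.min dt (pool e) in sx xf xh.
have Ab : \sum_(i | A i) P i <= b.
  by rewrite le_min Ad; apply: ler_sum_subset => k /A0.
have [allf|/existsNP[i /not_implyP[Ai /negP]]] :=
  pselect (forall i, A i -> upto e i < b).
  by apply: eq_bigr => i Ai; rewrite xf ?A0 ?allf.
rewrite -leNgt => bu.
have uA : upto e i <= \sum_(i | A i) P i.
  apply: ler_sum_subset => k /andP[_]; apply: contraLR => Ak.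
  by rewrite -ltNge; exact: Atop.
have bA : b = \sum_(i | A i) P i.
  by apply/eqP; rewrite eq_le Ab (le_trans bu).
rewrite -bA -sx [RHS](bigID A) /= [X in _ + X]big1 ?addr0 // => j Aj.
apply: xh; rewrite bA; apply: ler_sum_subset => k Ak.
by rewrite A0 //= Atop.
Qed.

(* The intervals ]higher, upto] of the nonempty groups tile ]0, pool], so
   cutting each of them at the demand gives the greedy shares of the groups
   without naming the marginal group. *)
Definition alloc dt e i : R :=
  if 0 < e i then
    P i * ((Num.max (higher e i) (Num.min dt (upto e i)) - higher e i) /
           (upto e i - higher e i))
  else 0.

Lemma alloc_bounds dt e i : 0 <= alloc dt e i <= P i.
Proof.
rewrite /alloc; case: ifPn => [ei|_]; last by rewrite lexx ltW.
have hu := higher_lt_upto ei.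
rewrite mulr_ge0 ?ler_piMr ?divr_ge0 ?subr_ge0 ?(ltW hu) ?(ltW (P_gt0 i)) //.
- by rewrite ler_pdivrMr ?subr_gt0 // mul1r lerD2r ge_max ltW //= ge_min lexx orbT.
- by rewrite le_max lexx.
Qed.

Lemma alloc_full dt e i : 0 < e i -> upto e i <= dt -> alloc dt e i = P i.
Proof.
move=> ei ud; have hu := higher_lt_upto ei.
by rewrite /alloc ei (min_r ud) (max_r (ltW hu)) divff ?mulr1 ?gt_eqF ?subr_gt0.
Qed.

Lemma alloc_zero dt e i : dt <= higher e i -> alloc dt e i = 0.
Proof.
move=> dh; rewrite /alloc; case: ifP => // _.
by rewrite max_l ?subrr ?mul0r ?mulr0 // ge_min dh.
Qed.

Lemma alloc_marginal dt e i : 0 < e i -> higher e i < dt <= upto e i ->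
  alloc dt e i = (dt - higher e i) / (upto e i - higher e i) * P i.
Proof.
by move=> ei /andP[hd du]; rewrite /alloc ei (min_l du) (max_r (ltW hd)) mulrC.
Qed.

Lemma alloc_min dt e i : alloc (Num.min dt (pool e)) e i = alloc dt e i.
Proof. by rewrite /alloc -minA (min_r (upto_le_pool _ _)). Qed.

(** Take the group of longest duration with [b <= upto]. Its [higher] is 0 or the [upto] of the next
    longer group, which is below [b] by maximality. *)
Lemma exists_marginal b e : 0 < b <= pool e ->
  exists i, 0 < e i /\ higher e i < b <= upto e i.
Proof.
move=> /andP[b0 bp].
have [k ek] : exists k, 0 < e k.
  apply/not_existsP => ne; move: (lt_le_trans b0 bp).
  by rewrite /pool big_pred0 ?ltxx // => j; apply/negbTE/negP/ne.
have [m em mmin] : exists2 m, 0 < e m &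
    forall j, 0 < e j -> e m / P m <= e j / P j.
  by case: (arg_minP (P := fun j => 0 < e j) (fun j => e j / P j) ek) => m; exists m.
have um : b <= upto e m.
  by rewrite (le_trans bp) //; apply: ler_sum_subset => j ej; rewrite ej mmin.
have Qm : (0 < e m) && (b <= upto e m) by rewrite em um.
case: (arg_maxP (P := fun j => (0 < e j) && (b <= upto e j))
  (fun j => e j / P j) Qm) => i /andP[ei bi] imax; exists i.
split=> //; rewrite bi andbT.
have [hi0|/eqP hin0] := pselect (higher e i = 0); first by rewrite hi0.
have [k' Ak'] : exists k', (0 < e k') && (e i / P i < e k' / P k').
  apply/not_existsP => ne; move/eqP: hin0; apply.
  by rewrite /higher big_pred0 // => j; apply/negbTE/negP/ne.
case: (arg_minP (P := fun j => (0 < e j) && (e i / P i < e j / P j))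
  (fun j => e j / P j) Ak') => j /andP[ej ij] jmin.
have -> : higher e i = upto e j.
  apply: eq_bigl => l; case el: (0 < e l) => //=.
  apply/idP/idP => [il|/(lt_le_trans ij)//].
  by apply: jmin; rewrite el.
rewrite ltNge; apply/negP => bj; move: ij; rewrite ltNge => /negP; apply.
by apply: imax; rewrite ej.
Qed.

(** Relative to a marginal store [i], the longer groups contribute [higher e i], the group of [i]
    the remainder [b - higher e i], and the shorter groups nothing. *)
Lemma sum_alloc dt e : 0 <= dt ->
  \sum_i alloc dt e i = Num.min dt (pool e).
Proof.
move=> dt0; under eq_bigr do rewrite -alloc_min.
set b := Num.min _ _.
have [b0|/negbTE/eqP bn0] := boolP (b == 0).
  rewrite (eqP b0) big1 // => i _; apply: alloc_zero; exact: sum_rate_ge0.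
have b0 : 0 < b.
  rewrite lt_neqAle eq_sym; apply/andP; split; first exact/eqP.
  by rewrite le_min dt0 sum_rate_ge0.
have bp : b <= pool e by rewrite ge_min lexx orbT.
clearbody b; have [|i [ei /andP[hb bu]]] := @exists_marginal b e; first by rewrite b0.
have hu := higher_lt_upto ei.
rewrite (bigID (fun j => 0 < e j)) /= [X in _ + X]big1 ?addr0; last first.
  by move=> j /negbTE ej; rewrite /alloc ej.
rewrite (bigID (fun j => e i / P i < e j / P j)) /=.
rewrite (eq_bigr P) -/(higher e i); last first.
  move=> j /andP[ej ij]; rewrite alloc_full // ltW //.
  exact: le_lt_trans (upto_le_higher ij) hb.
rewrite (bigID (fun j => e j / P j == e i / P i)) /= [X in _ + (_ + X)]big1.
  rewrite addr0; set l := (b - higher e i) / (upto e i - higher e i).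
  have -> : \sum_(j | (0 < e j) && ~~ (e i / P i < e j / P j) &&
      (e j / P j == e i / P i)) alloc b e j = l * (upto e i - higher e i).
    rewrite uptoE addrAC subrr add0r mulr_sumr; apply: eq_big.
      move=> j; rewrite -andbA; case: (0 < e j) => //=.
      by case: (ltgtP (e i / P i)).
    move=> j /andP[/andP[ej _] /eqP ji].
    by rewrite alloc_marginal // /l /higher /upto ?ji // -/(upto _ _) hb.
  by rewrite /l divfK ?gt_eqF ?subr_gt0 // [LHS]addrC subrK.
move=> j /andP[/andP[_ +] /negbTE]; case: (ltgtP (e i / P i)) => // ji _ _.
apply: alloc_zero; exact: le_trans bu (upto_le_higher ji).
Qed.

Lemma alloc_ggddf_rule dt e : 0 <= dt -> ggddf_rule P dt e (alloc dt e).
Proof.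
move=> dt0; rewrite /ggddf_rule -/(pool e); set b := Num.min _ _.
have bE : b = \sum_i alloc dt e i by rewrite sum_alloc.
case: eqP => [b0 i|bn0].
  rewrite -alloc_min -/b b0; apply: alloc_zero; exact: sum_rate_ge0.
have b0 : 0 < b.
  rewrite lt_neqAle eq_sym; apply/andP; split; first exact/eqP.
  by rewrite le_min dt0 sum_rate_ge0.
have [|i [ei /andP[hb bu]]] := @exists_marginal b e.
  by rewrite b0 ge_min lexx orbT.
have hu := higher_lt_upto ei.
(* [lambda] is the fraction of the marginal interval ]higher, upto] that lies below [b]. *)
exists ((b - higher e i) / (upto e i - higher e i)).
  by rewrite divr_gt0 ?subr_gt0 //= ler_pdivrMr ?subr_gt0 // mul1r lerD2r.
split=> // j; rewrite -alloc_min -/b -/(upto e j) -/(higher e j).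
case: ifPn => [/negbTE ej|/negPn ej]; first by rewrite /alloc ej.
case: ltP => [/ltW|bj]; first exact: alloc_full.
case: ltP => [hj|]; last exact: alloc_zero.
(* Both intervals ]higher, upto] contain [b], and those of different groups are disjoint. *)
have ji : e j / P j = e i / P i.
  apply/eqP; rewrite eq_le; apply/andP; split; rewrite leNgt; apply/negP => lt.
    have := lt_le_trans hb (le_trans bj (upto_le_higher lt)).
    by rewrite ltxx.
  have := lt_le_trans hj (le_trans bu (upto_le_higher lt)).
  by rewrite ltxx.
by rewrite alloc_marginal ?hj // /higher /upto ji.
Qed.

(** The energies enter only through their signs and the order of the durations, so the allocation
    can be frozen while these persist. *)
Lemma eq_alloc dt e e' : (forall i, (0 < e i) = (0 < e' i)) ->
  (forall i j, (e i / P i <= e j / P j) = (e' i / P i <= e' j / P j)) ->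
  alloc dt e = alloc dt e'.
Proof.
move=> pe le; apply/funext => i; rewrite /alloc pe.
have -> : higher e i = higher e' i.
  by apply: eq_bigl => j; rewrite pe !ltNge le.
by have -> : upto e i = upto e' i by apply: eq_bigl => j; rewrite pe le.
Qed.

(** This keeps tied durations tied: they fall at the same speed. *)
Lemma alloc_group dt e i j : e i / P i = e j / P j ->
  alloc dt e i / P i = alloc dt e j / P j.
Proof.
have Pn0 k : P k != 0 by rewrite gt_eqF.
move=> ij; rewrite /alloc -(duration_gt0 e i) -(duration_gt0 e j) ij.
case: ifP => _; last by rewrite !mul0r.
by rewrite /higher /upto ij ![P _ * _]mulrC !mulfK.
Qed.

End AllocationRule.

(** * Integrals over segments and almost-everywhere comparison *)

Section IntegralOverSegments.
Variable R : realType.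
Notation mu := (@lebesgue_measure R).
Notation I a b f := (Rintegral mu `[a, b]%classic f).
Implicit Types (a b c t : R) (f g : R -> R).

Lemma ae_imply (Q Q' : R -> Prop) : {ae mu, forall t, Q t} ->
  (forall t, Q t -> Q' t) -> {ae mu, forall t, Q' t}.
Proof.
by move=> h QQ'; apply: (@filterS _ _ (ae_filter_ringOfSetsType mu)) h.
Qed.

Lemma ae_and (Q Q' : R -> Prop) : {ae mu, forall t, Q t} ->
  {ae mu, forall t, Q' t} -> {ae mu, forall t, Q t /\ Q' t}.
Proof. by move=> h h'; exact: (@filterI _ _ (ae_filter_ringOfSetsType mu)). Qed.

Definition measurable_bounded a f :=
  measurable_fun [set t : R | a <= t] f /\
  exists M, forall t, a <= t -> `|f t| <= M.

Lemma measurable_ray a : measurable [set t : R | a <= t].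
Proof. by rewrite -set_itvcy; exact: measurable_itv. Qed.

Lemma measurable_bounded_integrable_itv a b c f :
  measurable_bounded a f -> a <= b -> mu.-integrable `[b, c] (EFin \o f).
Proof.
move=> [mf [M fM]] ab.
have sub : `[b, c]%classic `<=` [set t : R | a <= t].
  by move=> t /=; rewrite in_itv /= => /andP[/(le_trans ab)].
apply: measurable_bounded_integrable => //.
- by rewrite /= lebesgue_measure_itv /=; case: ifP => _; rewrite ?ltry // -EFinB ltry.
- by apply: measurable_funS mf => //; exact: measurable_ray.
- exists M; split; first exact: num_real.
  by move=> N MN t /sub /fM /le_trans; apply; exact: ltW.
Qed.

Lemma Rintegral_itv_add a b c f : mu.-integrable `[a, c] (EFin \o f) ->
  a <= b <= c -> I a c f = I a b f + I b c f.
Proof.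
move=> fi /andP[ab bc].
have := @Rintegral_itvB R f (BLeft a) (BRight c) b fi.
rewrite !bnd_simp => /(_ ab bc) => /eqP; rewrite subr_eq addrC => /eqP ->.
congr (_ + _); apply: Rintegral_itv_obnd_cbnd.
apply: integrableS fi => //; move=> t /=; rewrite !in_itv /= => /andP[bt ->].
by rewrite (le_trans ab (ltW bt)).
Qed.

Lemma ae_eq_Rintegral_norm b c f : mu.-integrable `[b, c] (EFin \o f) ->
  {ae mu, forall t, b <= t <= c -> 0 <= f t} ->
  (\int[mu]_(t in `[b, c]) (f t)%:E = \int[mu]_(t in `[b, c]) `|(f t)%:E|)%E.
Proof.
move=> fi f0; have mf := measurable_int _ fi.
apply: ae_eq_integral => //.
  exact: measurableT_comp mf.
by apply: (ae_imply f0) => t ft0 /=; rewrite in_itv /= => /ft0 ft; rewrite /= ger0_norm.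
Qed.

Lemma ae_Rintegral_ge0 b c f : mu.-integrable `[b, c] (EFin \o f) ->
  {ae mu, forall t, b <= t <= c -> 0 <= f t} -> 0 <= I b c f.
Proof.
move=> fi f0; rewrite /Rintegral (ae_eq_Rintegral_norm fi f0).
by apply: fine_ge0; exact: integral_ge0.
Qed.

Lemma integrable_itvB b c f g : mu.-integrable `[b, c] (EFin \o f) ->
  mu.-integrable `[b, c] (EFin \o g) ->
  mu.-integrable `[b, c] (EFin \o (fun t => f t - g t)).
Proof.
move=> fi gi; have := @integrableB _ _ _ mu _ (measurable_itv _) _ _ fi gi.
by apply: eq_integrable => // t _; rewrite /= EFinB.
Qed.

Lemma ae_ler_Rintegral b c f g : mu.-integrable `[b, c] (EFin \o f) ->
  mu.-integrable `[b, c] (EFin \o g) ->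
  {ae mu, forall t, b <= t <= c -> f t <= g t} -> I b c f <= I b c g.
Proof.
move=> fi gi fg; rewrite -subr_ge0 -RintegralB //.
apply: ae_Rintegral_ge0; first exact: integrable_itvB.
by apply: (ae_imply fg) => t fgt /fgt; rewrite subr_ge0.
Qed.

(** The difference [g - f] is almost everywhere nonnegative with zero integral, so the integral of
    its absolute value vanishes as well. *)
Lemma ae_ler_Rintegral_eq b c f g : mu.-integrable `[b, c] (EFin \o f) ->
  mu.-integrable `[b, c] (EFin \o g) ->
  {ae mu, forall t, b <= t <= c -> f t <= g t} -> I b c g <= I b c f ->
  {ae mu, forall t, b <= t <= c -> f t = g t}.
Proof.
move=> fi gi fg gf.
have hi : mu.-integrable `[b, c] (EFin \o (fun t => g t - f t)).
  exact: integrable_itvB.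
have h0 : {ae mu, forall t, b <= t <= c -> 0 <= g t - f t}.
  by apply: (ae_imply fg) => t fgt /fgt; rewrite subr_ge0.
have I0 : I b c (fun t => g t - f t) = 0.
  apply/eqP; rewrite eq_le ae_Rintegral_ge0 // andbT RintegralB //.
  by rewrite subr_le0.
have := ae_eq_Rintegral_norm hi h0.
rewrite -(fineK (integrable_fin_num _ hi)) // [X in X%:E](_ : _ = 0) //.
move=> /esym/ae_eq_integral_abs => /(_ (measurable_itv _) (measurable_int _ hi)).
move=> /ae_imply; apply => t /= ht bc; have := ht; rewrite in_itv /= => /(_ bc)[/eqP].
by rewrite subr_eq0 => /eqP ->.
Qed.

Lemma Rintegral_itv_cst b c (k : R) : b <= c -> I b c (cst k) = k * (c - b).
Proof.
move=> bc; rewrite Rintegral_cst //= lebesgue_measure_itv /= lte_fin.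
move: bc; rewrite le_eqVlt => /predU1P[->|bc]; first by rewrite ltxx subrr.
by rewrite bc.
Qed.

Lemma measurable_bounded_cst a (k : R) : measurable_bounded a (cst k).
Proof. by split; [exact: measurable_cst|exists `|k|]. Qed.

Lemma Rintegral_itv1 a f : I a a f = 0.
Proof. by rewrite set_itv1 Rintegral_set1. Qed.

Lemma Rintegral_itv_sum (J : finType) (A : pred J) (f : J -> R -> R) b c :
  (forall i, A i -> mu.-integrable `[b, c] (EFin \o f i)) ->
  I b c (fun t => \sum_(i | A i) f i t) = \sum_(i | A i) I b c (f i).
Proof.
move=> fi; elim: (index_enum J) => [|i s ih].
  under eq_Rintegral do rewrite big_nil.
  by rewrite big_nil Rintegral_cst // mul0r.
under eq_Rintegral do rewrite big_cons.
rewrite big_cons; case: ifPn => // Ai; rewrite -ih -RintegralD //; first exact: fi.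
have := @integrable_sum _ _ _ mu `[b, c]%classic (measurable_itv _) J s A
  (fun i => EFin \o f i) fi.
by apply: eq_integrable => // t _ /=; rewrite sumEFin.
Qed.

(** A bound [M] on [f] makes the integral [M]-Lipschitz, even across [a]: for [t < a] the segment is
    empty and the integral is 0. *)
Lemma measurable_bounded_Rintegral_continuous a f : measurable_bounded a f ->
  continuous (fun t => I a t f).
Proof.
move=> bf; have [mf [M fM]] := bf.
have M0 : 0 <= M by rewrite (le_trans _ (fM a _)).
have lip s t : s <= t -> `|I a t f - I a s f| <= M * (t - s).
  move=> st; have [as_|sa] := leP a s; last first.
    rewrite [X in _ - X](_ : _ = 0) ?subr0; last first.
      by rewrite set_itv_ge ?Rintegral_set0 // bnd_simp -ltNge.
    have [at_|ta] := leP a t; last first.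
      by rewrite set_itv_ge ?Rintegral_set0 ?normr0 ?mulr_ge0 ?subr_ge0 // bnd_simp -ltNge.
    rewrite (@le_trans _ _ (M * (t - a))) // ?ler_wpM2l ?lerD2l ?lerN2 ?(ltW sa) //.
    rewrite -Rintegral_itv_cst //.
    have fi := @measurable_bounded_integrable_itv _ a t _ bf (lexx _).
    apply: (le_trans (le_normr_Rintegral _ fi)) => //.
    apply: le_Rintegral => //; first exact: integrable_norm.
      exact: measurable_bounded_integrable_itv (measurable_bounded_cst a M) _.
    by move=> x /=; rewrite in_itv /= => /andP[/fM].
  rewrite (@Rintegral_itv_add a s t) ?as_ ?st //; last first.
    exact: measurable_bounded_integrable_itv bf _.
  rewrite addrAC subrr add0r -Rintegral_itv_cst //.
  have fi := @measurable_bounded_integrable_itv _ s t _ bf as_.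
  apply: (le_trans (le_normr_Rintegral _ fi)) => //.
  apply: le_Rintegral => //; first exact: integrable_norm.
    exact: measurable_bounded_integrable_itv (measurable_bounded_cst a M) _.
  by move=> x /=; rewrite in_itv /= => /andP[/(le_trans as_)/fM].
have lip2 s t : `|I a s f - I a t f| <= M * `|s - t|.
  have [st|/ltW ts] := leP s t.
    by rewrite distrC [X in _ * X]distrC (ger0_norm (x := t - s)) ?subr_ge0 // lip.
  by rewrite (ger0_norm (x := s - t)) ?subr_ge0 // lip.
move=> s; apply/cvgrPdist_lt => e e0.
(* [M] may be 0, and the radius [e / (M + 1)] has to be positive. *)
have M1 : 0 < M + 1 by rewrite ltr_wpDl.
near=> t; apply: (le_lt_trans (lip2 _ _)).
rewrite (@le_lt_trans _ _ ((M + 1) * `|s - t|)) ?ler_wpM2r ?lerDl //.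
rewrite mulrC -ltr_pdivlMr //; near: t.
by apply: cvgr_dist_lt; [exact: cvg_id|exact: divr_gt0].
Unshelve. all: by end_near. Qed.

End IntegralOverSegments.

(** * First and last times at which continuous functions are nonpositive *)

Section FirstHittingTime.
Variable R : realType.

Lemma closed_sup (A : set R) : closed A -> A !=set0 -> has_ubound A -> A (sup A).
Proof. by move=> cA A0 ubA; apply: cA; exact: closure_sup. Qed.

Lemma closed_least (A : set R) : closed A -> A !=set0 -> has_lbound A ->
  exists2 x, A x & forall y, A y -> x <= y.
Proof.
move=> cA [x0 Ax0] [l lA].
have cB : closed [set x : R | A (- x)].
  by apply: (closed_comp (f := -%R)) => // x _; exact: opp_continuous.
have ubB : has_ubound [set x : R | A (- x)].
  by exists (- l) => x /lA; rewrite lerNr.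
exists (- sup [set x : R | A (- x)]).
  by apply: (closed_sup cB) => //; exists (- x0); rewrite /= opprK.
by move=> y Ay; rewrite lerNl; apply: ub_le_sup; rewrite //= opprK.
Qed.

Lemma closed_nonpos (g : R -> R) : continuous g -> closed [set x | g x <= 0].
Proof.
move=> cg; apply: (closed_comp (f := g) (D := [set y : R | y <= 0])).
  by move=> x _; exact: cg.
exact: closed_le.
Qed.

(** The supremum of a nonempty bounded closed set belongs to it. The point is to isolate a final
    stretch on which [g] is positive throughout. *)
Lemma last_nonpos (g : R -> R) u t : continuous g -> u <= t -> g u <= 0 ->
  exists2 s, u <= s <= t & g s <= 0 /\ forall v, s < v <= t -> 0 < g v.
Proof.
move=> cg ut gu; pose A := [set x : R | u <= x <= t] `&` [set x | g x <= 0].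
have cA : closed A.
  apply: closedI; last exact: closed_nonpos.
  by rewrite -set_itvcc; exact: itv_closed.
have ubA : has_ubound A by exists t => x [/andP[]].
have Au : A u by split=> //=; rewrite lexx.
have [/= ust gs] := closed_sup cA (ex_intro _ u Au) ubA.
exists (sup A) => //; split=> // v /andP[sv vt]; rewrite ltNge; apply/negP => gv.
have : v <= sup A.
  apply: ub_le_sup => //; split=> //=; rewrite vt andbT.
  by move: ust => /andP[us _]; rewrite (le_trans us (ltW sv)).
by rewrite leNgt sv.
Qed.

(** The set of hitting times is closed, as a finite union of closed sets cut by a ray, so it has a
    least element. *)
Lemma first_nonpos (J : finType) (B : pred J) (h : J -> R -> R) a t :
  (forall k, continuous (h k)) -> (forall k, B k -> 0 < h k a) ->
  a <= t -> (exists2 k, B k & h k t <= 0) ->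
  exists s, [/\ a <= s, forall v k, a <= v < s -> B k -> 0 < h k v,
                forall k, B k -> 0 <= h k s & exists2 k, B k & h k s <= 0].
Proof.
move=> ch ha at_ [k0 Bk0 hk0].
pose T := [set x : R | a <= x] `&` \bigcup_(k in [set k | B k]) [set x | h k x <= 0].
have cT : closed T.
  apply: closedI; first exact: closed_ge.
  apply: closed_bigcup => [|k _]; [exact: finite_finset|exact: closed_nonpos].
have lT : has_lbound T by exists a => x [].
have Tt : T t by split=> //; exists k0.
have [s [/= as_ [k1 Bk1 hk1]] smin] := closed_least cT (ex_intro _ t Tt) lT.
have before v k : a <= v < s -> B k -> 0 < h k v.
  move=> /andP[av vs] Bk; rewrite ltNge; apply/negP => hv.
  have : s <= v by apply: smin; split=> //; exists k.
  by rewrite leNgt vs.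
exists s; split=> //; last by exists k1.
move=> k Bk; have [sa|/eqP san] := pselect (s = a); first by rewrite sa ltW // ha.
have a_lt_s : a < s by rewrite lt_neqAle eq_sym san.
rewrite leNgt; apply/negP => hs.
(* If [h k] were negative at [s], it would be negative on the whole stretch after its last
   nonnegative point [v < s], hence already before [s]. *)
have [v /andP[av vs] [hv hpos]] : exists2 v, a <= v <= s &
    - h k v <= 0 /\ forall w, v < w <= s -> 0 < - h k w.
  apply: (last_nonpos (g := fun x => - h k x)) => //.
    by move=> x; apply: cvgN; exact: ch.
  by rewrite oppr_le0 ltW // ha.
have v_lt_s : v < s.
  rewrite lt_neqAle vs andbT; apply/eqP => vs'.
  by move: hv; rewrite vs' oppr_le0 leNgt hs.
have [vm ms] := midf_lt v_lt_s.
have := hpos ((v + s) / 2); rewrite vm (ltW ms) => /(_ isT).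
rewrite oppr_gt0 ltNge ltW //; apply: before => //.
by rewrite (le_trans av (ltW vm)).
Qed.

End FirstHittingTime.

(** * Complete service by GGDDF policies *)

Section Completeness.
Variables (R : realType) (S : finType) (Ebar P P' eta E0 : S -> R) (d : R -> R).
Hypothesis P_gt0 : forall i, 0 < P i.
Notation mu := (@lebesgue_measure R).
Notation I a b f := (Rintegral mu `[a, b]%classic f).

Lemma policy_measurable_bounded r : policy Ebar P P' eta E0 d r ->
  forall i, measurable_bounded 0 (r i).
Proof.
move=> [mr [_ [br _]]] i; split; first exact: mr.
exists (`|P' i| + `|P i|) => t /(br i)/andP[lo hi].
have := (ler_norm (P' i), ler_norm (P i), normr_ge0 (P' i), normr_ge0 (P i)).
by rewrite ler_norml => -[[[? ?] ?] ?]; apply/andP; split; lra.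
Qed.

Lemma energy_sub r i u t : measurable_bounded 0 (r i) -> 0 <= u <= t ->
  energy E0 r i u - energy E0 r i t = I u t (r i).
Proof.
move=> br /andP[u0 ut]; rewrite /energy (@Rintegral_itv_add _ 0 u t) ?u0 //.
  by lra.
exact: measurable_bounded_integrable_itv br _.
Qed.

Lemma energy_continuous r i : measurable_bounded 0 (r i) ->
  continuous (energy E0 r i).
Proof.
move=> br t; apply: cvgB; first exact: cvg_cst.
exact: measurable_bounded_Rintegral_continuous br t.
Qed.

(** Let [s] be the last time in [u, t] at which the order still holds. On ]s, t] the duration of [i]
    is strictly larger, so by [ggddf_rule_anti] it falls at least as fast as that of [j], and the
    gap cannot have grown. *)
Lemma ggddf_duration_order r : (forall i, measurable_bounded 0 (r i)) ->
  ggddf P E0 d r -> forall i j u t, 0 <= u <= t ->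
  energy E0 r i u / P i <= energy E0 r j u / P j ->
  energy E0 r i t / P i <= energy E0 r j t / P j.
Proof.
move=> br gr i j u t /andP[u0 ut] le_u; rewrite -subr_le0.
pose g v := energy E0 r i v / P i - energy E0 r j v / P j.
have cg : continuous g.
  by move=> v; apply: cvgB; apply: cvgMr_tmp; exact: energy_continuous.
have [|s /andP[us st] [gs gpos]] := last_nonpos cg ut.
  by rewrite /g subr_le0.
apply: le_trans gs; rewrite -/(g t) -subr_ge0.
have s0 := le_trans u0 us.
have fi k : mu.-integrable `[s, t] (EFin \o (fun v => r k v / P k)).
  apply: (measurable_bounded_integrable_itv (a := 0)) => //.
  have [mk [M bM]] := br k; split; first exact: measurable_funM.
  exists (M / P k) => v /bM.
  rewrite normrM (@ger0_norm _ (P k)^-1) ?invr_ge0 ?(ltW (P_gt0 k)) //.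
  by rewrite ler_pM2r ?invr_gt0.
have sub k : energy E0 r k s / P k - energy E0 r k t / P k = I s t (fun v => r k v / P k).
  rewrite -mulrBl energy_sub ?s0 // RintegralZr //.
  exact: measurable_bounded_integrable_itv (br k) s0.
suff : I s t (fun v => r j v / P j) <= I s t (fun v => r i v / P i).
  by rewrite -!sub /g; lra.
apply: ae_ler_Rintegral => //.
(* The instant [s] is discarded as a null set: the strict inequality is known only after it. *)
have ns : {ae mu, forall v, v <> s}.
  by exists [set s]; split=> //= [|v]; [exact: lebesgue_measure_set1|move=> /= /contrapT].
apply: (ae_imply (ae_and gr ns)) => v [rule vs] /andP[sv vt].
have s_lt_v : s < v by rewrite lt_neqAle sv andbT; apply/eqP => /esym.
apply: (ggddf_rule_anti P_gt0 (rule (le_trans s0 sv))).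
by rewrite -subr_gt0; apply: gpos; rewrite s_lt_v.
Qed.

(** Cross-charging adds no energy: as [eta <= 1], the served rate is at most the sum of the rates. A
    store of [A] is then bounded by its maximal rate, any other store by its initial energy. *)
Lemma demand_le_dischargeable r (A : pred S) t :
  (forall i, 0 < eta i <= 1) ->
  (forall T, 0 <= T -> mu.-integrable `[0, T] (EFin \o d)) ->
  policy Ebar P P' eta E0 d r -> completely_serves eta d r -> 0 <= t ->
  I 0 t d <= \sum_(i | A i) P i * t + \sum_(i | ~~ A i) E0 i.
Proof.
move=> heta di pr sr t0; have br := policy_measurable_bounded pr.
have ri i : mu.-integrable `[0, t] (EFin \o r i).
  exact: measurable_bounded_integrable_itv (br i) _.
have [_ [er [rr _]]] := pr.
apply: (@le_trans _ _ (I 0 t (fun v => \sum_i r i v))).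
  apply: ae_ler_Rintegral; first exact: di.
    have := @integrable_sum _ _ _ mu `[0, t]%classic (measurable_itv _) S
      (index_enum S) predT (fun i => EFin \o r i) (fun i _ => ri i).
    by apply: eq_integrable => // v _ /=; rewrite sumEFin.
  apply: (ae_imply sr) => v sv /andP[v0 _]; rewrite -sv // /served.
  apply: ler_sum => i _; case: ifPn => //; rewrite -ltNge => rlt0.
  have /andP[e0 e1] := heta i.
  by rewrite ler_pdivrMr //; nra.
rewrite (Rintegral_itv_sum (A := predT)) // (bigID A) /=.
apply: lerD; apply: ler_sum => i _.
  rewrite (le_trans (y := I 0 t (cst (P i)))) //; last first.
    by rewrite Rintegral_itv_cst // subr0.
  apply: le_Rintegral => //.
    exact: measurable_bounded_integrable_itv (measurable_bounded_cst _ _) _.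
  by move=> v /=; rewrite in_itv /= => /andP[/(rr i)/andP[]].
by have /andP[] := er i t t0; rewrite /energy subr_ge0.
Qed.

(** The total rate is almost everywhere at most the demand, so it suffices that its integral reaches
    that of the demand. To this end [bound] is applied to the set of stores still nonempty at
    [t0]. *)
Lemma ggddf_serves_before r t0 :
  (forall T, 0 <= T -> mu.-integrable `[0, T] (EFin \o d)) ->
  (forall s t, 0 <= s -> s <= t -> d t <= d s) ->
  policy Ebar P P' eta E0 d r -> ggddf P E0 d r -> 0 <= t0 ->
  (forall A : pred S,
     I 0 t0 d <= \sum_(i | A i) P i * t0 + \sum_(i | ~~ A i) E0 i) ->
  \sum_(i | 0 < energy E0 r i t0) P i < d t0 ->
  {ae mu, forall t, 0 <= t <= t0 -> \sum_i r i t = d t}.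
Proof.
move=> di dd pr gr t00 bound short; have br := policy_measurable_bounded pr.
have [_ [er _]] := pr.
pose A := [pred i | 0 < energy E0 r i t0].
have ri i : mu.-integrable `[0, t0] (EFin \o r i).
  exact: measurable_bounded_integrable_itv (br i) _.
have sri (B : pred S) : mu.-integrable `[0, t0] (EFin \o (fun v => \sum_(i | B i) r i v)).
  have := @integrable_sum _ _ _ mu `[0, t0]%classic (measurable_itv _) S
    (index_enum S) B (fun i => EFin \o r i) (fun i _ => ri i).
  by apply: eq_integrable => // v _ /=; rewrite sumEFin.
apply: ae_ler_Rintegral_eq => //.
- exact: di.
- apply: (ae_imply gr) => t rule /andP[/rule/(ggddf_ruleP P_gt0)[-> _ _ _ _] _].
  by rewrite ge_min lexx.
- apply: (le_trans (bound A)); rewrite (Rintegral_itv_sum (A := predT)) //.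
  (* The stores outside [A] are empty at [t0], so they have delivered their initial energy. *)
  rewrite [leRHS](bigID A) /=; apply: lerD; last first.
    apply: ler_sum => i; rewrite -leNgt /energy subr_le0 => //.
  rewrite -Rintegral_itv_sum // -mulr_suml.
  rewrite (le_trans (y := I 0 t0 (cst (\sum_(i | A i) P i)))) //.
    by rewrite Rintegral_itv_cst // subr0.
  apply: ae_ler_Rintegral => //.
  + exact: measurable_bounded_integrable_itv (measurable_bounded_cst 0 _) _.
  apply: (ae_imply gr) => u rule /andP[u0 ut].
  (* At [u] the set [A] is a top set: its stores were nonempty because rates are nonnegative, and by
     order preservation no store empty at [t0] had as large a duration as one of [A]. The demand at
     [u] is at least that at [t0]. *)
  rewrite (ggddf_rule_top P_gt0 (rule u0)) //.
  + move=> i Ai; apply: (lt_le_trans Ai); rewrite -subr_ge0 energy_sub ?u0 //.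
    apply: ae_Rintegral_ge0.
      exact: measurable_bounded_integrable_itv (br i) _.
    apply: (ae_imply gr) => v rv /andP[uv _].
    by have [_ /(_ i)/andP[]] := ggddf_ruleP P_gt0 (rv (le_trans u0 uv)).
  + move=> i j Ai Aj; rewrite ltNge; apply/negP => le_u.
    have := ggddf_duration_order br gr (u := u) (t := t0) _ le_u.
    rewrite u0 ut => /(_ isT); apply/negP; rewrite -ltNge.
    apply: (@le_lt_trans _ _ 0); last first.
      by rewrite (duration_gt0 P_gt0 (energy E0 r ^~ t0)).
    by rewrite (duration_le0 P_gt0 (energy E0 r ^~ t0)) leNgt.
  + exact: le_trans (ltW short) (dd _ _ u0 ut).
Qed.

(** Up to a shortage time, service is complete outside a null set; rational end points make
    countably many such null sets suffice. A shortage time followed by another one lies below such a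
    rational, and at most one shortage time is the last. *)
Lemma ggddf_completely_serves r :
  (forall T, 0 <= T -> mu.-integrable `[0, T] (EFin \o d)) ->
  (forall s t, 0 <= s -> s <= t -> d t <= d s) ->
  policy Ebar P P' eta E0 d r -> ggddf P E0 d r ->
  (forall (A : pred S) t, 0 <= t ->
     I 0 t d <= \sum_(i | A i) P i * t + \sum_(i | ~~ A i) E0 i) ->
  completely_serves eta d r.
Proof.
move=> di dd pr gr bound.
pose short t := 0 <= t /\ \sum_(i | 0 < energy E0 r i t) P i < d t.
have rational q : {ae mu, forall t, (exists2 t0, short t0 & ratr q <= t0) ->
    0 <= t <= ratr q -> \sum_i r i t = d t}.
  have [[t0 [t00 st0] qt0]|nex] := pselect (exists2 t0, short t0 & ratr q <= t0);
    last by apply: aeW => t /nex.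
  have := ggddf_serves_before di dd pr gr t00 (fun A => bound A t0 t00) st0.
  move=> /ae_imply; apply => t ht _ /andP[t0' tq].
  by apply: ht; rewrite t0' (le_trans tq).
have allq : {ae mu, forall t q, (exists2 t0, short t0 & ratr q <= t0) ->
    0 <= t <= ratr q -> \sum_i r i t = d t}.
  (* Rationals are enumerated by their codes. A number that codes none is sent to 0, harmlessly,
     since [rational] holds for every [q]. *)
  have h n := rational (odflt 0 (unpickle n)).
  apply: (ae_imply (ae_foralln h)) => t ht q.
  by have := ht (pickle q); rewrite pickleK.
have nolast : {ae mu, forall t, ~ (short t /\ forall t', short t' -> t' <= t)}.
  have [[m [sm mmax]]|nex] :=
      pselect (exists m, short m /\ forall t', short t' -> t' <= m).
    exists [set m]; split=> //; first exact: lebesgue_measure_set1.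
    move=> t /= /contrapT[st tmax]; apply/eqP.
    by rewrite eq_le mmax //= tmax.
  by apply: aeW => t ht; apply: nex; exists t.
apply: (ae_imply (ae_and gr (ae_and allq nolast))) => t [rule [hq nl]] t0.
have [sr xb _ _ _] := ggddf_ruleP P_gt0 (rule t0).
have -> : served eta r t = \sum_i r i t.
  by apply: eq_bigr => i _; have /andP[-> _] := xb i.
have [st|nst] := pselect (short t); last first.
  rewrite sr; apply: min_l; rewrite leNgt; apply/negP => lt; apply: nst.
  by split.
have [t' st' tt'] : exists2 t', short t' & t < t'.
  apply: contrapT => ne; apply: nl; split=> // t' st'; rewrite leNgt.
  by apply/negP => tt'; apply: ne; exists t'.
have [q qtt'] := rat_in_itvoo tt'.
move: qtt'; rewrite in_itv /= => /andP[tq qt'].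
by apply: (hq q); [exists t' => //; exact: ltW|rewrite t0 ltW].
Qed.

End Completeness.

(** * Construction of a GGDDF policy, phase by phase *)

Section Existence.
Variables (R : realType) (S : finType) (P : S -> R) (d : R -> R).
Hypothesis P_gt0 : forall i, 0 < P i.
Hypothesis d_ge0 : forall t, 0 <= t -> 0 <= d t.
Hypothesis d_meas : measurable_fun [set t : R | 0 <= t] d.
Notation mu := (@lebesgue_measure R).
Notation I a b f := (Rintegral mu `[a, b]%classic f).
Implicit Types (E e : S -> R) (r : S -> R -> R) (o : option S).

(* [None] stands for an always empty store: emptying then is a special case of
   two stores reaching the same duration. *)
Definition duration e o : R := if o is Some i then e i / P i else 0.

Definition level E a r t i : R := E i - I a t (r i).

(** The cardinal of this set is the induction measure: along the construction a pair can only leave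
    it, by becoming tied. *)
Definition inversions e : {set option S * option S} :=
  [set p | duration e p.1 < duration e p.2].

(** The order is frozen at the energies [E] of the start of the phase; only the demand varies with
    [t]. *)
Definition phase_rate E i t : R := alloc P (d t) E i.

Lemma phase_rate_bounded E a i : 0 <= a -> measurable_bounded a (phase_rate E i).
Proof.
move=> a0; split.
  have sub : [set t : R | a <= t] `<=` [set t : R | 0 <= t].
    by move=> t /=; exact: le_trans.
  have md : measurable_fun [set t : R | a <= t] d.
    by apply: measurable_funS d_meas => //; exact: measurable_ray.
  rewrite /phase_rate /alloc; case: (0 < E i); last exact: measurable_cst.
  apply: measurable_funM; first exact: measurable_cst.
  apply: measurable_funM; last exact: measurable_cst.
  apply: measurable_funB; last exact: measurable_cst.
  apply: measurable_maxr; first exact: measurable_cst.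
  by apply: measurable_minr => //; exact: measurable_cst.
exists (P i) => t _; have /andP[lo hi] := alloc_bounds P_gt0 (d t) E i.
by rewrite ger0_norm.
Qed.

Lemma phase_duration_continuous E a o : 0 <= a ->
  continuous (fun t => duration (level E a (phase_rate E) t) o).
Proof.
move=> a0; case: o => [i|] t; last exact: cvg_cst.
apply: cvgMr_tmp; apply: cvgB; first exact: cvg_cst.
exact: measurable_bounded_Rintegral_continuous (phase_rate_bounded E i a0) t.
Qed.

(** Tied stores discharge in proportion to [P] by [alloc_group]; a store tied with [None] is empty
    and stays idle. *)
Lemma phase_duration_eq E a t o o' : 0 <= a -> (forall i, 0 <= E i) ->
  duration E o = duration E o' ->
  duration (level E a (phase_rate E) t) o =
  duration (level E a (phase_rate E) t) o'.
Proof.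
move=> a0 E0; pose rate o v : R :=
  if o is Some i then phase_rate E i v / P i else 0.
have ratei i : mu.-integrable `[a, t] (EFin \o phase_rate E i).
  exact: measurable_bounded_integrable_itv (phase_rate_bounded E i a0) _.
have dE q : duration (level E a (phase_rate E) t) q =
    duration E q - I a t (rate q).
  case: q => [i|] /=; first by rewrite /level mulrBl RintegralZr.
  by rewrite Rintegral_cst // mul0r subrr.
have empty i : E i / P i = 0 -> E i = 0.
  by move/eqP; rewrite mulf_eq0 invr_eq0 (gt_eqF (P_gt0 i)) orbF => /eqP.
move=> eq_oo'; rewrite !dE eq_oo'; congr (_ - _); apply: eq_Rintegral => v _.
case: o o' eq_oo' => [i|] [j|] //=.
- exact: alloc_group.
- by move=> /empty Ei0; rewrite /phase_rate /alloc Ei0 ltxx mul0r.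
- by move=> /esym/empty Ej0; rewrite /phase_rate /alloc Ej0 ltxx mul0r.
Qed.

Lemma phase_rule E a t : 0 <= a <= t -> (forall i, 0 <= E i) ->
  (forall o o', duration E o < duration E o' ->
     duration (level E a (phase_rate E) t) o <
     duration (level E a (phase_rate E) t) o') ->
  (forall i, 0 <= level E a (phase_rate E) t i) /\
  ggddf_rule P (d t) (level E a (phase_rate E) t) (phase_rate E ^~ t).
Proof.
move=> /andP[a0 at_] E0 mono; set e := level _ _ _ _.
have mono_le o o' : (duration E o <= duration E o') =
    (duration e o <= duration e o').
  case: (ltgtP (duration E o) (duration E o')) => [/mono/ltW ->//|/mono|].
    by rewrite ltNge => /negbTE ->.
  by move=> /(phase_duration_eq t a0 E0) ->; rewrite lexx.
have pos i : (0 < E i) = (0 < e i).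
  rewrite -(duration_gt0 P_gt0 E) -(duration_gt0 P_gt0 e) !ltNge; congr (~~ _).
  exact: (mono_le (Some i) None).
split.
  move=> i; have := mono_le None (Some i).
  rewrite /= (divr_ge0 (E0 i) (ltW (P_gt0 i))) => /esym.
  by rewrite pmulr_lge0 // invr_gt0.
have -> : phase_rate E ^~ t = alloc P (d t) e.
  by apply: eq_alloc => // i j; exact: (mono_le (Some i) (Some j)).
by apply: alloc_ggddf_rule => //; apply: d_ge0; exact: le_trans at_.
Qed.

Lemma ggddf_rate_bounded E a r : 0 <= a ->
  (forall i, measurable_fun [set t : R | a <= t] (r i)) ->
  (forall t, a <= t -> ggddf_rule P (d t) (level E a r t) (r ^~ t)) ->
  forall i, measurable_bounded a (r i).
Proof.
move=> a0 mr rule i; split; first exact: mr.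
exists (P i) => t /rule /(ggddf_ruleP P_gt0)[_ /(_ i)/andP[lo hi] _ _ _].
by rewrite ger0_norm.
Qed.

(** The switching time belongs to [r2], since a new tie at [s] may already change the allocation
    there. *)
Definition splice (s : R) r1 r2 i t : R := if t < s then r1 i t else r2 i t.

Lemma measurable_splice s r1 r2 a i : a <= s ->
  measurable_fun [set t : R | a <= t] (r1 i) ->
  measurable_fun [set t : R | s <= t] (r2 i) ->
  measurable_fun [set t : R | a <= t] (splice s r1 r2 i).
Proof.
move=> as_ m1 m2.
have -> : [set t : R | a <= t] = `[a, s[%classic `|` [set t : R | s <= t].
  apply/seteqP; split=> t /=; rewrite in_itv /=.
    by move=> ->; case: (ltP t s); [left|right].
  by case=> [/andP[]|/(le_trans as_)].
apply/measurable_funU; [exact: measurable_itv|exact: measurable_ray|split].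
  apply: (eq_measurable_fun (r1 i)).
    by move=> t; rewrite inE /= in_itv /= /splice => /andP[_ ->].
  apply: measurable_funS m1; first exact: measurable_ray.
  by move=> t /=; rewrite in_itv /= => /andP[].
apply: (eq_measurable_fun (r2 i)) => // t.
by rewrite inE /= /splice ltNge => ->.
Qed.

Lemma level_splice_lt s r1 r2 E a t : t < s ->
  level E a (splice s r1 r2) t = level E a r1 t.
Proof.
move=> ts; apply/funext => i; congr (_ - _); apply: eq_Rintegral => v.
by rewrite inE /= in_itv /= /splice => /andP[_ /le_lt_trans -> //].
Qed.

Lemma level_splice_ge s r1 r2 E a t : 0 <= a -> a <= s <= t ->
  (forall i, measurable_bounded a (r1 i)) ->
  (forall i, measurable_bounded a (splice s r1 r2 i)) ->
  level E a (splice s r1 r2) t = level (level E a r1 s) s r2 t.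
Proof.
move=> a0 /andP[as_ st] b1 bs; apply/funext => i; rewrite /level.
rewrite (@Rintegral_itv_add _ a s t) ?as_ //; last first.
  exact: measurable_bounded_integrable_itv (bs i) _.
have -> : I s t (splice s r1 r2 i) = I s t (r2 i).
  apply: eq_Rintegral => v; rewrite inE /= in_itv /= /splice => /andP[sv _].
  by rewrite ltNge sv.
have sub : [set` `[a, s[ ] `<=` [set` `[a, s]].
  by move=> v /=; rewrite !in_itv /= => /andP[-> /ltW].
have -> : I a s (splice s r1 r2 i) = I a s (r1 i).
  rewrite -!Rintegral_itv_bndo_bndc.
  - apply: eq_Rintegral => v; rewrite inE /= in_itv /= /splice.
    by move=> /andP[_ ->].
  - have := measurable_bounded_integrable_itv s (b1 i) (lexx a).
    by apply: integrableS => //; exact: measurable_itv.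
  - have := measurable_bounded_integrable_itv s (bs i) (lexx a).
    by apply: integrableS => //; exact: measurable_itv.
by rewrite opprD addrA.
Qed.

Lemma ggddf_from E a : 0 <= a -> (forall i, 0 <= E i) ->
  exists r, (forall i, measurable_fun [set t : R | a <= t] (r i)) /\
    forall t, a <= t -> (forall i, 0 <= level E a r t i) /\
      ggddf_rule P (d t) (level E a r t) (r ^~ t).
Proof.
have [n] := ubnP #|inversions E|.
elim: n => // n ih in E a * => cardE a0 E0.
pose r1 := phase_rate E.
have b1 i := phase_rate_bounded E i a0.
pose dur t := duration (level E a r1 t).
pose h (p : option S * option S) t := dur t p.2 - dur t p.1.
have [nohit|hit] := pselect (forall t, a <= t ->
    forall p, p \in inversions E -> 0 < h p t).
  exists r1; split; first by move=> i; case: (b1 i).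
  move=> t at_; apply: phase_rule; rewrite ?a0 // => o o' oo'.
  rewrite -subr_gt0; apply: (nohit t at_ (o, o')); by rewrite inE.
have level_a : level E a r1 a = E.
  by apply/funext => i; rewrite /level Rintegral_itv1 subr0.
have [t at_ [p Ep hp]] : exists2 t, a <= t &
    exists2 p, p \in inversions E & h p t <= 0.
  apply: contrapT => ne; apply: hit => t at_ p Ep; rewrite ltNge.
  by apply/negP => hp; apply: ne; exists t => //; exists p.
have [||s [as_ before at_s [q Eq hq]]] := @first_nonpos _ _
    (fun p => p \in inversions E) h a t _ _ at_ (ex_intro2 _ _ p Ep hp).
- by move=> k x; apply: cvgB; exact: phase_duration_continuous.
- by move=> k; rewrite inE /h /dur level_a subr_gt0.
pose E1 := level E a r1 s.
(* The weak order survives at [s]. Comparison with [None] then gives nonnegative energies, and no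
   new strictly ordered pair can appear. *)
have mono o o' : duration E o <= duration E o' ->
    duration E1 o <= duration E1 o'.
  rewrite le_eqVlt => /predU1P[/(phase_duration_eq s a0 E0) ->//|oo'].
  by rewrite -subr_ge0; apply: (at_s (o, o')); rewrite inE.
have E10 i : 0 <= E1 i.
  have := mono None (Some i).
  rewrite /= (divr_ge0 (E0 i) (ltW (P_gt0 i))) => /(_ isT).
  by rewrite pmulr_lge0 // invr_gt0.
(* The inclusion is strict because the pair [q] is tied at [s]. *)
have sub : inversions E1 \proper inversions E.
  apply/properP; split.
    apply/fintype.subsetP; case=> o o'; rewrite !inE /= !ltNge; apply: contra.
    exact: mono.
  exists q => //; rewrite inE -leNgt -subr_le0; exact: hq.
have [|r2 [m2 rule2]] := ih E1 s _ (le_trans a0 as_) E10.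
  exact: leq_trans (proper_card sub) _.
pose r := splice s r1 r2.
have mr i : measurable_fun [set t : R | a <= t] (r i).
  by apply: measurable_splice => //; case: (b1 i).
have b2 := ggddf_rate_bounded (le_trans a0 as_) m2 (fun t st => (rule2 t st).2).
have br i : measurable_bounded a (r i).
  split=> //; have [[_ [M1 bM1]] [_ [M2 bM2]]] := (b1 i, b2 i).
  exists (Num.max M1 M2) => v av; rewrite le_max /r /splice.
  by case: ltP => [_|/bM2 ->]; rewrite ?orbT // bM1.
exists r; split=> // v av; have [vs|sv] := ltP v s.
  rewrite (level_splice_lt _ _ _ _ vs).
  have -> : r ^~ v = r1 ^~ v by apply/funext => i; rewrite /r /splice vs.
  apply: phase_rule; rewrite ?a0 // => o o' oo'.
  rewrite -subr_gt0; apply: (before v (o, o')); first by rewrite av.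
  by rewrite inE.
rewrite (level_splice_ge _ a0 _ b1 br) ?as_ //.
have -> : r ^~ v = r2 ^~ v.
  by apply/funext => i; rewrite /r /splice ltNge sv.
exact: rule2.
Qed.

End Existence.

(** * Assembly of existence and completeness *)

Lemma measurable_locally_integrable (R : realType) (f : R -> R) :
  (forall T, 0 <= T -> lebesgue_measure.-integrable `[0, T] (EFin \o f)) ->
  measurable_fun [set t : R | 0 <= t] f.
Proof.
move=> fi; have -> : [set t : R | 0 <= t] = \bigcup_n `[0, n%:R]%classic.
  apply/seteqP; split=> t /=; last by case=> n _ /=; rewrite in_itv /= => /andP[].
  move=> t0; exists (Num.trunc t).+1 => //=.
  by rewrite in_itv /= t0 ltW // truncnS_gt.
apply/measurable_fun_bigcup => [n|n]; first exact: measurable_itv.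
by apply/measurable_EFinP; exact: measurable_int (fi n%:R (ler0n _ _)).
Qed.

Unset Implicit Arguments.

Theorem theorem2 (R : realType) (S : finType)
  (Ebar P P' eta E0 : S -> R) (d : R -> R)
  (hEbar : forall i, 0 < Ebar i) (hP : forall i, 0 < P i)
  (hP' : forall i, 0 <= P' i) (heta : forall i, 0 < eta i <= 1)
  (hd0 : forall t, 0 <= t -> 0 <= d t)
  (hdint : forall T, 0 <= T ->
     lebesgue_measure.-integrable `[0, T] (fun t => (d t)%:E))
  (hdec : forall s t, 0 <= s -> s <= t -> d t <= d s) :
  (exists r, policy Ebar P P' eta E0 d r /\ completely_serves eta d r) ->
  (exists r, policy Ebar P P' eta E0 d r /\
     (forall i t, 0 <= t -> 0 <= r i t) /\
     ggddf P E0 d r /\ completely_serves eta d r) /\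
  (forall r, policy Ebar P P' eta E0 d r -> ggddf P E0 d r ->
     completely_serves eta d r).
Proof.
move=> [rc [prc src]].
have bound (A : pred S) t (t0 : 0 <= t) :=
  demand_le_dischargeable A heta hdint prc src t0.
have complete r : policy Ebar P P' eta E0 d r -> ggddf P E0 d r ->
    completely_serves eta d r.
  by move=> pr gr; apply: (ggddf_completely_serves hP hdint hdec pr gr).
split=> //.
(* The given cross-charging policy, read at time 0, shows that the initial energies respect the
   capacities. *)
have E0b i : 0 <= E0 i <= Ebar i.
  have [_ [/(_ i 0 (lexx _))]] := prc.
  by rewrite /energy Rintegral_itv1 subr0.
have [|r [mr rule]] :=
  ggddf_from hP hd0 (measurable_locally_integrable hdint) (lexx 0) (E := E0).
  by move=> i; have /andP[] := E0b i.
have rP i t : 0 <= t -> 0 <= r i t <= P i.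
  by move=> /rule[_ /(ggddf_ruleP hP)[_ /(_ i)]].
have gr : ggddf P E0 d r by apply: aeW => t /rule[].
have pr : policy Ebar P P' eta E0 d r.
  split=> //; split; [|split].
  - move=> i t t0; have [/(_ i) e0 _] := rule t t0; rewrite e0 /=.
    (* Without charging, no store rises above its initial energy. *)
    have /andP[_] := E0b i; apply: le_trans; rewrite lerBlDr lerDl.
    apply: Rintegral_ge0 => v /=; rewrite in_itv /= => /andP[v0 _].
    by have /andP[] := rP i v v0.
  - move=> i t /(rP i)/andP[lo ->]; rewrite andbT (le_trans _ lo) //.
    by rewrite oppr_le0.
  - move=> t t0; have [_ /(ggddf_ruleP hP)[sr _ _ _ _]] := rule t t0.
    have -> : served eta r t = \sum_i r i t.
      by apply: eq_bigr => i _; have /andP[->] := rP i t t0.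
    rewrite sr le_min hd0 //= ge_min lexx andbT.
    exact: sum_rate_ge0.
exists r; split=> //; split; last by split=> //; exact: complete.
by move=> i t /(rP i)/andP[].
Qed.
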